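(* Let $A\in BL(X)$. Define $M(A):=\sup\{\|A-\lambda I\|:\lambda\in\sigma(A)\}$. Then $$d_1(A)\ge\max\left\{\epsilon>0:\ \sigma_{\frac{2\epsilon}{M(A)}}(A)\cap\{z:\operatorname{Re} z>0\}=\emptyset\right\}$$ and $$d_1(A)\le\max\left\{\epsilon>0:\ \sigma_{\frac{\epsilon}{\epsilon+2\|A\|}}(A)\cap\{z:\operatorname{Re} z>0\}=\emptyset\right\}.$$
   Context: $X$ is a complex Banach space and $BL(X)$ is the Banach algebra of all bounded linear operators on $X$, with identity $I$. The spectrum of $A\in BL(X)$ is $\sigma(A)=\{z\in\mathbb{C}: A-zI \text{ is not invertible}\}$. For $0<\delta<1$ the $\delta$-condition pseudospectrum of $A$ is $$\sigma_\delta(A)=\sigma(A)\cup\{z\in\mathbb{C}: \|A-zI\|\,\|(A-zI)^{-1}\|\ge \delta^{-1}\},$$ and $\sigma_1(A)=\mathbb{C}$. An operator $A\in BL(X)$ is said to be stable if $\sigma(A)\cap\{z:\operatorname{Re} z>0\}=\emptyset$. The distance to instability of $A$ is $$d_1(A):=\min\{\|E\|: A+E\text{ is not stable}\}=\min\{\|E\|: \sigma(A+E)\cap\{z:\operatorname{Re} z>0\}\neq\emptyset\}.$$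
   Formalization: ''min'' in d_1(A) is read as an infimum and ''max'' as a supremum in [0,∞] (0 for the empty set), since neither need be attained (e.g. A = −I on ℂ); X is nonzero, and σ_δ(A) is taken to be ℂ when δ>1 or when M(A)=0 makes 2ε/M(A) undefined. *)

(* Defs.v *)
From HB Require Import structures.
From mathcomp Require Import all_boot all_order all_algebra.
From mathcomp Require Import all_classical all_reals all_analysis.
From mathcomp Require Import complex.

Set Implicit Arguments.
Unset Strict Implicit.
Unset Printing Implicit Defensive.

Import Order.TTheory GRing.Theory Num.Theory.
Import numFieldNormedType.Exports.

Local Open Scope classical_set_scope.
Local Open Scope ring_scope.

(* For linear maps between normed spaces, continuity is boundedness
   ([linear_bounded_continuous]). *)
#[short(type="boundedLinearType")]
HB.structure Definition BoundedLinear (K : numFieldType)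
    (X Y : normedModType K) :=
  {f of @GRing.Linear K X Y *:%R f & @Continuous X Y f}.

Notation BL X := (boundedLinearType X X).

Section bounded_linear_instances.
Context (K : numFieldType) (X Y : normedModType K).
Implicit Types f g : boundedLinearType X Y.

Fact add_bl_continuous f g : continuous (f \+ g).
Proof. by move=> x; apply: cvgD; exact: cts_fun. Qed.

Fact sub_bl_continuous f g : continuous (f \- g).
Proof. by move=> x; apply: cvgB; exact: cts_fun. Qed.

Fact scale_bl_continuous (a : K) f : continuous (a \*: f).
Proof. by move=> x; apply: cvgZl_tmp; exact: cts_fun. Qed.

HB.instance Definition _ f g :=
  @isContinuous.Build X Y (f \+ g) (@add_bl_continuous f g).
HB.instance Definition _ f g :=
  @isContinuous.Build X Y (f \- g) (@sub_bl_continuous f g).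
HB.instance Definition _ (a : K) f :=
  @isContinuous.Build X Y (a \*: f) (@scale_bl_continuous a f).
HB.instance Definition _ := Continuous.on (@idfun X).

End bounded_linear_instances.

Section condition_pseudospectrum.
Context (R : realType) (X : completeNormedModType R[i]).
Implicit Types (A B E : BL X) (z : R[i]).

(* The norm of X takes its values in the nonnegative reals of R[i]; Re
   retrieves them as elements of R. *)
Definition opnorm A : R :=
  sup [set complex.Re `|A x| | x in [set x : X | `|x| <= 1]].

Definition addop A B : BL X := A \+ B.

Definition subscalar A z : BL X := A \- z \*: idfun.

Definition is_inverse A B : Prop := cancel A B /\ cancel B A.

Definition spectrum A : set R[i] :=
  [set z | ~ exists B, is_inverse (subscalar A z) B].

(* Only 0 < delta <= 1 is meaningful, with the value setT at delta = 1.
   - For delta > 1, setT is also what the formula for 0 < delta < 1 would give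
     if X is nonzero, a condition number being at least 1.
   - delta = 0 arises as 2 * eps / 0, when maxdist A = 0 (A is then a scalar
     operator); setT amounts to reading this quotient as infinite. *)
Definition cond_pseudospectrum (delta : R) A : set R[i] :=
  if 0 < delta < 1 then
    spectrum A `|`
    [set z | exists2 B, is_inverse (subscalar A z) B &
               opnorm (subscalar A z) * opnorm B >= delta^-1]
  else setT.

Definition right_half_plane : set R[i] := [set z | 0 < complex.Re z].

Definition stable A : Prop := spectrum A `&` right_half_plane = set0.

(* An infimum: it is in general not attained, e.g. for A = - I on R[i]. *)
Definition dist_instability A : \bar R :=
  ereal_inf [set (opnorm E)%:E | E in [set E | ~ stable (addop A E)]].

Definition maxdist A : R := sup [set opnorm (subscalar A l) | l in spectrum A].

(* The largest element of a set S of positive reals, as a supremum in [0, +oo]: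
   it is 0 when S is empty and +oo when S is unbounded (which happens below for
   A = - I). *)
Definition max_pos (S : set R) : \bar R :=
  ereal_sup (0%E |` [set r%:E | r in S]).

End condition_pseudospectrum.

Arguments right_half_plane {R}.

(* Main.v *)
(* Write k = ||A - z I|| ||(A - z I)^-1||.
   Lower bound: if z lies in the spectrum of A + E but not in that of A, then
   ||(A - z I)^-1|| ||E|| >= 1 (Neumann), and M(A) <= 2 ||A - z I|| because
   ||A - l I|| <= ||A - z I|| + |l - z| and l - z is in the spectrum of
   A - z I; hence k >= M(A) / (2 ||E||).
   Upper bound: if k >= (eps + 2 ||A||) / eps then |z| <= eps + ||A||, since
   otherwise k <= (|z| + ||A||) / (|z| - ||A||) < (eps + 2 ||A||) / eps; so
   ||(A - z I)^-1|| >= 1 / eps, and a rank-one perturbation of norm close to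
   1 / ||(A - z I)^-1||, provided by the Hahn-Banach theorem, puts z in the
   spectrum. *)
Require Import Defs.
From HB Require Import structures.
From mathcomp Require Import all_boot all_order all_algebra.
From mathcomp Require Import all_classical all_reals all_analysis.
From mathcomp Require Import complex.
From mathcomp Require Import ring lra.
Import Order.TTheory GRing.Theory Num.Theory.
Import numFieldNormedType.Exports.
Local Open Scope classical_set_scope.
Local Open Scope ring_scope.

Local Notation nrm x := (complex.Re `|x|).

(** * The real Hahn-Banach theorem for a sublinear bound *)

Section hahn_banach.
Context {R : realType} {V : lmodType R} (p : V -> R).
Hypothesis pD : forall x y, p (x + y) <= p x + p y.
Hypothesis pZ : forall (r : R) x, 0 < r -> p (r *: x) = r * p x.
Implicit Types (G : set (V * R)) (x y : V).

Let p0 : p 0 = 0.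
Proof. by have := pZ 2 0 (ltr0Sn _ _); rewrite scaler0; lra. Qed.

(* Graph of a linear form on a subspace of [V], dominated by [p]. *)
Let dominated_graph G := [/\ G (0, 0),
  forall a u v, G u -> G v -> G (a *: u.1 + v.1, a * u.2 + v.2) &
  forall u, G u -> u.2 <= p u.1].

Let graphZ {G} a u : dominated_graph G -> G u -> G (a *: u.1, a * u.2).
Proof. by move=> [G0 Gl _] Gu; have := Gl a u _ Gu G0; rewrite /= !addr0. Qed.

Let graph_functional {G x r s} :
  dominated_graph G -> G (x, r) -> G (x, s) -> r = s.
Proof.
move=> [G0 Gl Gp]; suff H t1 t2 : G (x, t1) -> G (x, t2) -> t1 <= t2.
  by move=> Gr Gs; apply/le_anti; rewrite !H.
move=> G1 G2; have := Gp _ (Gl (-1) _ _ G2 G1).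
by rewrite /= scaleN1r addNr p0; lra.
Qed.

(** Splitting [u.1 + v.1] as [(u.1 - y) + (v.1 + y)], subadditivity puts every lower bound
    [u.2 - p (u.1 - y)] for the value at [y] below every upper bound [p (v.1 + y) - v.2]; the
    supremum of the lower bounds serves as [c]. *)
Let gap G y : dominated_graph G -> exists c,
  forall u, G u -> u.2 + c <= p (u.1 + y) /\ u.2 - c <= p (u.1 - y).
Proof.
move=> [G0 Gl Gp]; pose S := [set u.2 - p (u.1 - y) | u in G].
have Sub v : G v -> ubound S (p (v.1 + y) - v.2).
  move=> Gv _ [u Gu <-]; have := Gp _ (Gl 1 _ _ Gu Gv).
  rewrite /= scale1r mul1r; have := pD (u.1 - y) (v.1 + y).
  by rewrite addrACA addNr addr0; lra.
exists (sup S) => u Gu; split.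
  have : sup S <= p (u.1 + y) - u.2.
    apply: ge_sup; last exact: Sub.
    by exists (0 - p (0 - y)), (0, 0).
  by lra.
have : u.2 - p (u.1 - y) <= sup S.
  apply: ub_le_sup; last by exists u.
  by exists (p (0 + y) - 0); exact: (Sub (0, 0)).
by lra.
Qed.

Let extend G y : dominated_graph G ->
  exists c, exists2 G', dominated_graph G' & G `<=` G' /\ G' (y, c).
Proof.
move=> dG; have [c cG] := gap G y dG; have [G0 Gl Gp] := dG; exists c.
exists [set w | exists u t, G u /\ w = (u.1 + t *: y, u.2 + t * c)]; last first.
  split=> [u Gu|]; first exists u, 0.
    by rewrite scale0r mul0r !addr0; case: u Gu.
  by exists (0, 0), 1; rewrite scale1r mul1r !add0r.
split=> [|a _ _ [u [t [Gu ->]]] [v [s [Gv ->]]]|_ [u [t [Gu ->]]]] /=.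
- by exists (0, 0), 0; rewrite scale0r mul0r !addr0.
- exists (a *: u.1 + v.1, a * u.2 + v.2), (a * t + s); split; first exact: Gl.
  congr pair => /=; last by ring.
  by rewrite scalerDr scalerA addrACA -scalerDl.
(* For [t != 0], apply the choice of [c] to [u] divided by [|t|] and scale back; each sign of [t]
   uses one of the two inequalities. *)
- have [t0|t0|->] := ltgtP t 0; last 1 first.
  + by rewrite scale0r mul0r !addr0 Gp.
  + have s0 : 0 < - t by rewrite oppr_gt0.
    have [_] := cG _ (graphZ (- t)^-1 u dG Gu).
    rewrite -(ler_pM2l s0) -pZ //= scalerBr mulrBr mulVKf ?gt_eqF //.
    by rewrite scalerA mulfV ?gt_eqF // scale1r mulNr scaleNr !opprK.
  + have [+ _] := cG _ (graphZ t^-1 u dG Gu).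
    rewrite -(ler_pM2l t0) -pZ //= scalerDr mulrDr mulVKf ?gt_eqF //.
    by rewrite scalerA mulfV ?gt_eqF // scale1r.
Qed.

(** Zorn's lemma gives a maximal dominated graph above the line through [x0]; by [extend] its domain
    is all of [V]. *)
Lemma hahn_banach x0 : exists f : V -> R,
  [/\ scalar f, forall x, f x <= p x & f x0 = p x0].
Proof.
pose L : set (V * R) := [set (a *: x0, a * p x0) | a in setT].
have dL : dominated_graph L.
  split=> [|b _ _ [s _ <-] [t _ <-]|_ [a _ <-]] /=.
  - by exists 0 => //; rewrite scale0r mul0r.
  - exists (b * s + t) => //=.
    by rewrite scalerDl mulrDl -scalerA -mulrA.
  - have [a0|a0|->] := ltgtP a 0; last 1 first.
    + by rewrite scale0r mul0r p0.
    (* For [a < 0], this reads [0 <= p (a *: x0) + (- a) * p x0]. *)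
    + have := pD (a *: x0) ((- a) *: x0).
      by rewrite scaleNr subrr p0 -scaleNr (pZ (- a)) ?oppr_gt0 //; lra.
    + by rewrite pZ.
(* The empty set is allowed since it is the union of the empty chain. *)
pose P G := G = set0 \/ dominated_graph G /\ L `<=` G.
have [|G [PG Gmax]] := @Zorn_bigcup _ P.
  move=> F FP Ftot.
  have [[G [FG Gn0]]|F0] := pselect (exists G, F G /\ G !=set0); last first.
    left; rewrite -subset0 => u [G FG Gu]; apply: F0.
    by exists G; split => //; exists u.
  have FP' H u : F H -> H u -> dominated_graph H /\ L `<=` H.
    by move=> FH Hu; case: (FP H FH) => [H0|//]; rewrite H0 in Hu.
  have [u Gu] := Gn0; have [dG LG] := FP' _ _ FG Gu.
  right; split; last by move=> v /LG Gv; exists G.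
  split; first by exists G => //; case: dG.
    move=> a v w [H FH Hv] [K FK Kw].
    have [dH _] := FP' _ _ FH Hv; have [dK _] := FP' _ _ FK Kw.
    have [HK|KH] := Ftot _ _ FH FK.
      by exists K => //; have [_ Kl _] := dK; apply: Kl => //; exact: HK.
    by exists H => //; have [_ Hl _] := dH; apply: Hl => //; exact: KH.
  by move=> v [H FH Hv]; have [[_ _ Hp] _] := FP' _ _ FH Hv; exact: Hp.
have [dG LG] : dominated_graph G /\ L `<=` G.
  case: PG => // G0; exfalso; apply: (Gmax L); last by right; split.
  by rewrite G0; split=> [u []|/(_ (0, 0))]; last by apply; case: dL.
have /choice[f Gf] x : exists r, G (x, r).
  have [c [G' dG' [GG' G'x]]] := extend G x dG; exists c.
  apply: contrapT => nGx; apply: (Gmax G'); last first.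
    by right; split => //; exact: subset_trans GG'.
  by split => // /(_ _ G'x).
have [_ Gl Gp] := dG; exists f; split=> [a x y|x|].
- apply: (graph_functional dG (Gf _)).
  by have := Gl a _ _ (Gf x) (Gf y).
- exact: (Gp _ (Gf x)).
- apply: (graph_functional dG (Gf _)); apply: LG.
  by exists 1 => //; rewrite scale1r mul1r.
Qed.

End hahn_banach.

(** * Norms and moduli over [R[i]] as real numbers *)

Section real_norm.
Context {R : realType} {V : normedModType R[i]}.
Implicit Types (x y : V) (a : R[i]).

Lemma normC_nrm x : `|x| = (nrm x)%:C%C.
Proof. by apply/esym/RRe_real/ger0_real. Qed.

Lemma nrm_ge0 x : 0 <= nrm x.
Proof. by rewrite -ler0c -normC_nrm. Qed.

Lemma nrm_eq0 x : nrm x = 0 -> x = 0.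
Proof. by move=> x0; apply/normr0_eq0; rewrite normC_nrm x0. Qed.

Lemma nrm_gt0 x : x != 0 -> 0 < nrm x.
Proof.
move=> x0; rewrite lt_neqAle nrm_ge0 andbT eq_sym.
by apply: contra_neq x0; exact: nrm_eq0.
Qed.

Lemma nrm0 : nrm (0 : V) = 0.
Proof. by rewrite normr0. Qed.

Lemma nrmN x : nrm (- x) = nrm x.
Proof. by rewrite normrN. Qed.

Lemma nrmB x y : nrm (x - y) = nrm (y - x).
Proof. by rewrite distrC. Qed.

Lemma nrmD x y : nrm (x + y) <= nrm x + nrm y.
Proof. by rewrite -lecR rmorphD /= -!normC_nrm ler_normD. Qed.

Lemma nrm_le_distD x y : nrm x <= nrm (x - y) + nrm y.
Proof. by rewrite -[in leLHS](subrK y x) nrmD. Qed.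

End real_norm.

Section complex_norm.
Context {R : realType}.
Implicit Types (a b : R[i]) (r : R).

Lemma Cnorm_nrm a : `|a| = (nrm a)%:C%C.
Proof. by apply/esym/RRe_real/ger0_real. Qed.

Lemma Cnrm_ge0 a : 0 <= nrm a.
Proof. by rewrite -ler0c -Cnorm_nrm. Qed.

Lemma CnrmM a b : nrm (a * b) = nrm a * nrm b.
Proof. by apply: complexI; rewrite rmorphM /= -!Cnorm_nrm normrM. Qed.

Lemma CnrmV a : nrm a^-1 = (nrm a)^-1.
Proof. by apply: complexI; rewrite fmorphV /= -!Cnorm_nrm normfV. Qed.

Lemma Cnrm_real r : nrm r%:C%C = `|r|.
Proof. by rewrite normc_def /= expr0n /= addr0 sqrtr_sqr. Qed.

Lemma Re_le_nrm a : complex.Re a <= nrm a.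
Proof.
by apply: le_trans (ler_norm _) _; rewrite -lecR -Cnorm_nrm normc_ge_Re.
Qed.

Lemma nrmZ {V : normedModType R[i]} a (x : V) : nrm (a *: x) = nrm a * nrm x.
Proof.
apply: complexI; rewrite rmorphM /= -(normC_nrm x) -(normC_nrm (a *: x)).
by rewrite -Cnorm_nrm normrZ.
Qed.

End complex_norm.

(** Banach's fixed point theorem: the iterates of [g] from 0 form a Cauchy sequence, and their limit
    is fixed. *)
Lemma contraction_has_fixpoint {R : realType} {X : completeNormedModType R[i]}
    (g : X -> X) (q : R) : 0 <= q -> q < 1 ->
  (forall x y, nrm (g x - g y) <= q * nrm (x - y)) -> exists x, g x = x.
Proof.
move=> q0 q1 gq; pose y n := iter n g 0; pose D := nrm (g 0) / (1 - q).
have q1' : 0 < 1 - q by rewrite subr_gt0.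
(* By this equation [g] maps the ball of radius [D] about 0 into itself, so all iterates stay in
   it. *)
have DE : D = q * D + nrm (g 0).
  by have qN1 := lt0r_neq0 q1'; rewrite /D; field.
have yD m : nrm (y m) <= D.
  elim: m => [|m ih]; first by rewrite nrm0 divr_ge0 ?nrm_ge0 ?ltW.
  rewrite DE /=; apply: le_trans (nrm_le_distD _ (g 0)) _.
  by rewrite lerD2r (le_trans (gq _ _)) // subr0 ler_wpM2l.
have yq n m : nrm (y (n + m)%N - y n) <= q ^+ n * D.
  elim: n => [|n ih]; first by rewrite subr0 expr0 mul1r; exact: yD.
  by rewrite exprS -mulrA; apply: le_trans (gq _ _) _; rewrite ler_wpM2l.
have qn e : 0 < e -> exists N, q ^+ N * D < e.
  move=> e0; have : (fun n => q ^+ n * D) @ \oo --> 0 * D.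
    apply: cvgMr_tmp; have := @cvg_geometric R 1 q.
    rewrite ger0_norm // => /(_ q1); apply: cvg_trans.
    by apply: near_eq_cvg; near=> n; rewrite /geometric/= mul1r.
  rewrite mul0r => /cvgrPdist_lt/(_ _ e0)[N _ /(_ N (leqnn N))].
  by rewrite sub0r normrN => /(le_lt_trans (ler_norm _)); exists N.
have cy : cvg (y @ \oo).
  apply/cauchy_cvgP/cauchy_exP => e e0.
  have [N yN] : exists N, q ^+ N * D < complex.Re e.
    by apply: qn; move: e0; rewrite ltcE => /andP[].
  exists (y N); exists N => // n /= Nn; rewrite -ball_normE /= distrC normC_nrm.
  (* A positive element of [R[i]] is real, so the estimate against [Re e] suffices. *)
  have /andP[/eqP Ime _] : (complex.Im e == 0) && (0 < complex.Re e).
    by move: e0; rewrite ltcE.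
  rewrite ltcE /= Ime eqxx /= -(subnKC Nn).
  exact: le_lt_trans (yq _ _) yN.
exists (lim (y @ \oo)); set l := lim _.
apply/eqP; rewrite -subr_eq0; apply/eqP/nrm_eq0/eqP.
rewrite eq_le nrm_ge0 andbT; apply/ler_addgt0Pr => e e0; rewrite add0r.
have e20 : 0 < (e / 2)%:C%C :> R[i] by rewrite ltcR divr_gt0.
have /cvgrPdist_lt/(_ _ e20)[N _ lN] := cy.
have {}lN n : (N <= n)%N -> nrm (l - y n) <= e / 2.
  by move=> /lN /=; rewrite normC_nrm ltcR => /ltW.
(* The intermediate point [g (y N)] is the next iterate, hence also close to [l]. *)
rewrite -(subrKA (g (y N))) (le_trans (nrmD _ _)) // (splitr e) lerD //.
  apply: le_trans (gq _ _) _; apply: le_trans (lN N _) => //.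
  by rewrite ler_piMl ?nrm_ge0 ?ltW.
by rewrite nrmB; exact: (lN N.+1 (leqnSn N)).
Unshelve. all: by end_near. Qed.

(** * Operator norm, bounded inverses and their perturbation *)

Section bounded_operators.
Context {R : realType} {X : completeNormedModType R[i]}.
Implicit Types (A B E S T : BL X) (x y : X) (a z : R[i]) (r d : R).

(* After [linearP] and the like, images go through another coercion path than
   [A x], on which later rewrites fail. *)
Lemma blP A a x y : A (a *: x + y) = a *: A x + A y.
Proof. exact: linearP. Qed.

Lemma blZ A a x : A (a *: x) = a *: A x.
Proof. exact: linearZ. Qed.

Lemma blB A x y : A (x - y) = A x - A y.
Proof. exact: linearB. Qed.

Lemma bl0 A : A 0 = 0.
Proof. exact: linear0. Qed.

Lemma bl_bounded A : exists2 C : R, 0 <= C & forall x, nrm (A x) <= C * nrm x.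
Proof.
have /linear_bounded_continuous/linear_boundedP[M [Mr AM]] :
  continuous A := @cts_fun _ _ A.
have M1 : M < `|M| + 1 by rewrite (le_lt_trans (real_ler_norm Mr)) // ltrDl.
exists (nrm M + 1) => [|x]; first by rewrite addr_ge0 ?Cnrm_ge0.
have := AM _ M1 x; rewrite (normC_nrm x) (normC_nrm (A x)) Cnorm_nrm.
by rewrite -[1]/(1%:C%C) -rmorphD -rmorphM /= lecR.
Qed.

Lemma opnorm_le A r : 0 <= r ->
  (forall x, nrm (A x) <= r * nrm x) -> opnorm A <= r.
Proof.
move=> r0 Ar; apply: ge_sup.
  by exists (nrm (A 0)), 0 => //=; rewrite normr0 ler01.
move=> _ [x /= x1 <-]; apply: le_trans (Ar x) _; rewrite ler_piMr //.
by rewrite -lecR -normC_nrm.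
Qed.

Lemma opnorm_ub A x : nrm x <= 1 -> nrm (A x) <= opnorm A.
Proof.
move=> x1; apply: ub_le_sup; last first.
  by exists x => //=; rewrite normC_nrm lecR.
have [C C0 AC] := bl_bounded A; exists C => _ [y /= y1 <-].
apply: le_trans (AC y) _; rewrite ler_piMr //.
by rewrite -lecR -normC_nrm.
Qed.

Lemma opnorm_ge0 A : 0 <= opnorm A.
Proof.
by apply: le_trans (opnorm_ub A 0 _); rewrite ?bl0 nrm0 ?ler01.
Qed.

Lemma nrm_le_opnorm A x : nrm (A x) <= opnorm A * nrm x.
Proof.
have [->|x0] := eqVneq x 0; first by rewrite bl0 !nrm0 mulr0.
have := nrm_gt0 _ x0 => nx0; rewrite -ler_pdivrMr // mulrC.
have nZ y : nrm ((nrm x)^-1%:C%C *: y) = (nrm x)^-1 * nrm y.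
  by rewrite nrmZ Cnrm_real ger0_norm ?invr_ge0 ?ltW.
by rewrite -nZ -blZ opnorm_ub // nZ mulVf ?gt_eqF.
Qed.

(** Inverses and rank-one operators arise as plain functions; this turns them into elements of
    [BL X]. *)
Lemma bl_build (f : X -> X) (C : R) : linear f ->
  (forall x, nrm (f x) <= C * nrm x) -> exists A : BL X, A =1 f.
Proof.
move=> lf fC.
pose g0 := GRing.isLinear.Build _ _ _ _ f lf.
pose g : {linear X -> X} := HB.pack f g0.
have cg : continuous g.
  apply/bounded_linear_continuous/linear_boundedP.
  exists C%:C%C; split; first by apply/complex_realP; exists C.
  move=> M CM x; apply: le_trans (_ : C%:C%C * `|x| <= _); last first.
    by rewrite ler_wpM2r // ltW.
  by rewrite (normC_nrm x) (normC_nrm (g x)) -rmorphM /= lecR; exact: fC.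
pose g1 := @isContinuous.Build X X f cg.
pose h : BL X := HB.pack f g0 g1.
by exists h.
Qed.


(** Read at [x = f y], the lower bound on [S] is the bound on its inverse [f]. *)
Lemma bl_inverse S (C : R) : injective S -> (forall y, exists x, S x = y) ->
  (forall x, nrm x <= C * nrm (S x)) -> exists B, is_inverse S B.
Proof.
move=> Sinj /choice[f Sf] SC.
have lf : linear f.
  by move=> a x y; apply: Sinj; rewrite blP !Sf.
have [||B Bf] := bl_build f C => //.
  by move=> x; rewrite -{2}(Sf x).
by exists B; split=> x; rewrite Bf //; apply: Sinj; rewrite Sf.
Qed.

(* The equation [S x = y] is the fixed point equation
   [x = x - B (S x - y)], whose right-hand side is a contraction in [x]. *)
Lemma is_inverse_perturb T B S d : is_inverse T B -> 0 <= d ->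
  opnorm B * d < 1 -> (forall x, nrm (S x - T x) <= d * nrm x) ->
  exists B', is_inverse S B'.
Proof.
move=> [TB BT] d0 q1 STd; set q := opnorm B * d in q1.
have q0 : 0 <= q by rewrite mulr_ge0 ?opnorm_ge0.
have q1' : 0 < 1 - q by rewrite subr_gt0.
have Bq x : nrm (B (S x - T x)) <= q * nrm x.
  rewrite -mulrA (le_trans (nrm_le_opnorm _ _)) // ler_wpM2l ?opnorm_ge0 //.
(* From [x = B (T x) = B (S x) - B (S x - T x)], absorbing the last term on the left. *)
have SC x : nrm x <= (1 - q)^-1 * opnorm B * nrm (S x).
  rewrite -mulrA ler_pdivlMl // mulrBl mul1r lerBlDr.
  apply: le_trans (lerD (nrm_le_opnorm B (S x)) (Bq x)).
  rewrite blB TB [X in _ + X]nrmB /=.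
  by apply: le_trans (nrmD _ _); rewrite addrC subrK.
apply: (bl_inverse S _ _ _ SC) => [x y Sxy|y].
  apply/eqP; rewrite -subr_eq0; apply/eqP/nrm_eq0/eqP.
  rewrite eq_le nrm_ge0 andbT (le_trans (SC _)) //.
  by rewrite blB Sxy subrr nrm0 mulr0.
have [x xE] : exists x, x - B (S x) + B y = x.
  apply: (contraction_has_fixpoint _ _ q0 q1) => u v.
  apply: le_trans (Bq _); rewrite -[leRHS]nrmN.
  suff -> : u - B (S u) + B y - (v - B (S v) + B y)
            = - B (S (u - v) - T (u - v)) by [].
  rewrite opprD addrACA subrr addr0 opprD opprK addrACA.
  by rewrite (blB B) TB opprB (blB S) (blB B) opprB [- _ + _]addrC.
exists x; apply: (can_inj BT); apply/esym/eqP; rewrite -subr_eq0.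
by apply/eqP/(addrI x); rewrite addr0 -[RHS]xE addrA addrAC.
Qed.

Lemma opnorm_subscalar A z : opnorm (subscalar A z) <= opnorm A + nrm z.
Proof.
apply: opnorm_le => [|x]; first by rewrite addr_ge0 ?opnorm_ge0 ?Cnrm_ge0.
rewrite mulrDl -nrmZ -[nrm (z *: x)]nrmN (le_trans (nrmD _ _)) //.
by rewrite lerD2r nrm_le_opnorm.
Qed.

(** If [|z|] exceeds the norm of [A], then [A - z I] perturbs [- z I] by [A], and the inverse of
    [- z I] has norm at most [1 / |z|]. *)
Lemma spectrum_le_opnorm A z : spectrum A z -> nrm z <= opnorm A.
Proof.
move=> zA; rewrite leNgt; apply/negP => Az; apply: zA.
have z0 : 0 < nrm z := le_lt_trans (opnorm_ge0 _) Az.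
have zn0 : z != 0 by apply: contraTneq z0 => ->; rewrite normr0 ltxx.
pose T : BL X := (- z) \*: idfun; pose B : BL X := (- z)^-1 \*: idfun.
have TB : is_inverse T B.
  by split=> x /=; rewrite scalerA ?mulVf ?mulfV ?scale1r ?oppr_eq0.
apply: (is_inverse_perturb T B _ (opnorm A)); rewrite ?opnorm_ge0 //.
  apply: (@le_lt_trans _ _ ((nrm z)^-1 * opnorm A)); last first.
    by rewrite ltr_pdivrMl // mulr1.
  rewrite ler_wpM2r ?opnorm_ge0 // opnorm_le // ?invr_ge0 ?ltW // => x /=.
  by rewrite nrmZ CnrmV normrN.
by move=> x /=; rewrite scaleNr opprK subrK nrm_le_opnorm.
Qed.

(** * The lower bound for the distance to instability *)

Lemma maxdist_le A z : maxdist A <= 2 * opnorm (subscalar A z).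
Proof.
have [[l lA]|noA] := pselect (exists l, spectrum A l); last first.
  (* Here [maxdist A] is the supremum of the empty set, by default 0. *)
  rewrite /maxdist (_ : [set _ | _ in _] = set0) ?sup0 ?mulr_ge0 ?opnorm_ge0 //.
  by rewrite -subset0 => _ [l lA <-]; apply: noA; exists l.
apply: ge_sup; first by exists (opnorm (subscalar A l)), l.
move=> _ [{lA}l lA <-].
have lzE x : subscalar A l x = subscalar A z x - (l - z) *: x.
  by rewrite /= scalerBl opprB addrA subrK.
have : nrm (l - z) <= opnorm (subscalar A z).
  apply: spectrum_le_opnorm => -[B [AB BA]]; apply: lA; exists B.
  split=> x; [rewrite lzE; exact: AB|rewrite lzE; exact: BA].
move=> lz; rewrite mulrDl mul1r; apply: opnorm_le => [|x].
  by rewrite addr_ge0 ?opnorm_ge0.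
rewrite lzE (le_trans (nrmD _ _)) // nrmN nrmZ mulrDl lerD ?nrm_le_opnorm //.
by rewrite ler_wpM2r ?nrm_ge0.
Qed.

Lemma opnorm_ge_of_spectrum A E B z : is_inverse (subscalar A z) B ->
  spectrum (addop A E) z -> 1 <= opnorm B * opnorm E.
Proof.
move=> AB zAE; rewrite leNgt; apply/negP => BE1; apply: zAE.
apply: (is_inverse_perturb _ _ _ _ AB (opnorm_ge0 E) BE1) => x /=.
by rewrite (addrAC (A x)) addrC addrK nrm_le_opnorm.
Qed.

Lemma dist_instability_ge A :
  (max_pos [set eps : R | (0 < eps)%R /\
       cond_pseudospectrum (2 * eps / maxdist A)%R A
         `&` right_half_plane = set0] <= dist_instability A)%E.
Proof.
apply: le_ereal_inf_tmp => _ [E /= nE <-]; apply: ge_ereal_sup => x [->|].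
  by rewrite lee_fin opnorm_ge0.
move=> [e [e0 eA] <-]; rewrite lee_fin leNgt; apply/negP => Ee; apply: nE.
move: eA; rewrite /cond_pseudospectrum; case: ifPn => [|_]; last first.
  (* Outside [0 < delta < 1] the pseudospectrum is the whole plane, which meets the half plane at
     1. *)
  by rewrite setTI => /seteqP[/(_ 1) /= h _]; case: h; exact: ltr01.
move=> /andP[d0 d1] eA; apply/seteqP; split => // z [zAE z0].
have M0 : 0 < maxdist A.
  by move: d0; rewrite pmulr_rgt0 ?mulr_gt0 // invr_gt0.
have zA : ~ spectrum A z.
  by move=> zA; move/seteqP: eA => [/(_ z)+ _]; apply; split => //; left.
have [B AB] : exists B, is_inverse (subscalar A z) B by exact: contrapT.
move/seteqP: eA => [/(_ z)+ _]; apply; split => //; right; exists B => //.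
have BE := opnorm_ge_of_spectrum _ _ _ _ AB zAE.
have Mz := maxdist_le A z.
(* With [1 <= opnorm B * opnorm E <= opnorm B * e], the bound [Mz] on [maxdist A] yields the
   condition. *)
rewrite invf_div ler_pdivrMr ?mulr_gt0 //.
apply: (le_trans Mz); rewrite [leRHS]mulrCA ler_pM2l // -mulrA.
rewrite ler_peMr ?opnorm_ge0 // (le_trans BE) // ler_wpM2l ?opnorm_ge0 //.
exact: ltW.
Qed.

End bounded_operators.

(** * Restriction of scalars to [R], and norming functionals on complex spaces *)

Definition realified {R : realType} (X : lmodType R[i]) : Type := X.

Section realification.
Context {R : realType} (X : lmodType R[i]).

HB.instance Definition _ := GRing.Zmodule.on (realified X).

Let scale (r : R) (x : realified X) : realified X := (r%:C%C *: (x : X) : X).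

Fact realified_scalerA a b v : scale a (scale b v) = scale (a * b) v.
Proof. by rewrite /scale scalerA -rmorphM. Qed.

Fact realified_scale1r : left_id 1 scale.
Proof. by move=> v; rewrite /scale scale1r. Qed.

Fact realified_scalerDr : right_distributive scale +%R.
Proof. by move=> a u v; rewrite /scale -scalerDr. Qed.

Fact realified_scalerDl v : {morph scale^~ v : a b / a + b}.
Proof. by move=> a b; rewrite /scale rmorphD -scalerDl. Qed.

HB.instance Definition _ := GRing.Zmodule_isLmodule.Build R (realified X)
  realified_scalerA realified_scale1r realified_scalerDr realified_scalerDl.

End realification.

(* The complex form is recovered from its real part [g] as
   [x |-> g x - i g (i x)]. *)
Lemma norming_functional {R : realType} {X : normedModType R[i]} (x0 : X) :
  exists f : X -> R[i],
    [/\ scalar f, forall x, nrm (f x) <= nrm x & nrm x0 <= nrm (f x0)].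
Proof.
have [|r x r0|g [gl gp gx0]] :=
  @hahn_banach R (realified X) (fun x => nrm (x : X)) _ _ x0.
- by move=> x y; exact: nrmD.
- by rewrite nrmZ Cnrm_real gtr0_norm.
have gD x y : g (x + y) = g x + g y.
  by have := gl 1 x y; rewrite scale1r mul1r.
have g0 : g 0 = 0 by have := gD 0 0; rewrite addr0; lra.
have gZ (r : R) (x : X) : g (r%:C%C *: x) = r * g x.
  by have := gl r x 0; rewrite g0 !addr0.
pose f (x : X) : R[i] := (g x -i* g ('i%C *: x))%C.
have fl : scalar f.
  move=> [s t] x y.
  have aE : (s +i* t)%C = s%:C%C + t%:C%C * 'i%C :> R[i].
    by rewrite [LHS]complexE /= mulrC.
  have iaE : 'i%C * (s +i* t)%C = s%:C%C * 'i%C + (- t)%:C%C :> R[i].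
    by simpc.
  rewrite /f scalerDr scalerA iaE aE !scalerDl -!scalerA !gD !gZ.
  by apply/eqP; rewrite eq_complex /=; apply/andP; split; apply/eqP; ring.
exists f; split=> // [x|]; last by rewrite -gx0; exact: (Re_le_nrm (f x0)).
have [fx0|fx0] := eqVneq (f x) 0; first by rewrite fx0 normr0 nrm_ge0.
(* Rotating [x] by the unimodular [w] makes the value of [f] real, hence equal to [g (w *: x)],
   which the norm of [x] bounds. *)
pose w := `|f x| / f x.
have fw : f (w *: x) = `|f x|.
  have := fl w x 0; rewrite addr0 => ->.
  have -> : f 0 = 0 by rewrite /f scaler0 g0 oppr0.
  by rewrite addr0 divfK.
rewrite -fw; apply: le_trans (gp _) _.
rewrite nrmZ CnrmM CnrmV normr_id mulfV ?mul1r //.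
by apply: contra_neq fx0 => fx0; apply/normr0_eq0; rewrite Cnorm_nrm fx0.
Qed.

(** * The upper bound for the distance to instability *)

Section upper_bound.
Context {R : realType} {X : completeNormedModType R[i]}.
Implicit Types (A B E : BL X) (z : R[i]) (r : R).

Lemma opnorm_approx B r : r < opnorm B -> exists2 x, nrm x <= 1 & r < nrm (B x).
Proof.
move=> /sup_gt[|_ [x /= x1 <-] rx].
  by exists (nrm (B 0)), 0; rewrite //= normr0 ler01.
by exists x => //; rewrite -lecR -normC_nrm.
Qed.

(** Take [x] in the unit ball with [|B x| > r] and [f] norming [B x]. The operator
    [E u = - (f u / f (B x)) x] sends [B x] to [- x], which cancels [(A - z I) (B x) = x], so
    [A + E - z I] kills the nonzero vector [B x]. *)
Lemma spectrum_rank_one A B z r : is_inverse (subscalar A z) B ->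
  0 < r -> r < opnorm B ->
  exists2 E, opnorm E <= r^-1 & spectrum (addop A E) z.
Proof.
move=> [AB BA] r0 /opnorm_approx[x x1 rBx].
have [f [fl fle fBx]] := norming_functional (B x).
have nB0 : 0 < nrm (f (B x)) := lt_le_trans r0 (le_trans (ltW rBx) fBx).
have fB0 : f (B x) != 0 by apply: contraTneq nB0 => ->; rewrite normr0 ltxx.
have Eb u : nrm (- (f u / f (B x)) *: x) <= r^-1 * nrm u.
  rewrite nrmZ normrN CnrmM CnrmV -[leRHS]mulr1 [r^-1 * _]mulrC.
  rewrite !ler_pM ?mulr_ge0 ?invr_ge0 ?nrm_ge0 ?Cnrm_ge0 //.
  by rewrite lef_pV2 ?posrE // (le_trans (ltW rBx)).

have [|E Ef] := bl_build (fun u => - (f u / f (B x)) *: x) r^-1 _ Eb.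
  move=> a u v; rewrite fl !scaleNr scalerN -opprD; congr (- _).
  by rewrite scalerA -scalerDl mulrDl mulrA.
exists E; first by apply: opnorm_le => [|u]; rewrite ?invr_ge0 ?(ltW r0) // Ef.
move=> [B' [B'K _]].
have Bx0 : subscalar (addop A E) z (B x) = 0.
  have := BA x; rewrite /= Ef mulfV // scaleN1r addrAC => ->; exact: subrr.
have := lt_le_trans nB0 (fle (B x)).
by rewrite -[B x]B'K Bx0 bl0 nrm0 ltxx.
Qed.

Lemma dist_instability_le_opnorm A E z : 0 < complex.Re z ->
  spectrum (addop A E) z -> (dist_instability A <= (opnorm E)%:E)%E.
Proof.
move=> z0 zAE; apply: ereal_inf_lbound; exists E => //= /seteqP[/(_ z) h _].
by apply: h.
Qed.

Lemma inverse_opnorm_ge A B z r : 0 < r -> 0 < opnorm A ->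
  is_inverse (subscalar A z) B ->
  (r / (r + 2 * opnorm A))^-1 <= opnorm (subscalar A z) * opnorm B ->
  r^-1 <= opnorm B.
Proof.
move=> r0 A0 [AB BA]; rewrite invf_div ler_pdivrMr // => cond.
rewrite leNgt; apply/negP; rewrite -[ltRHS]mul1r ltr_pdivlMr // => Br.
have nz := opnorm_subscalar A z.
have B0 := opnorm_ge0 B; set b := opnorm B in cond Br B0 *.
have bb : (opnorm A + nrm z) * (b * r) >= r + 2 * opnorm A.
  by rewrite mulrA; apply: le_trans cond _; rewrite !ler_wpM2r // ltW.
have zA : r + opnorm A < nrm z.
  have : (opnorm A + nrm z) * (b * r) < opnorm A + nrm z.
    by rewrite gtr_pMr ?ltr_wpDr ?Cnrm_ge0.
  by lra.
have k0 : 0 < nrm z - opnorm A by lra.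
(* From [z B x = A (B x) - x], the norm of [B x] times [|z| - opnorm A] is at most that of [x]. *)
have : b <= (nrm z - opnorm A)^-1.
  apply: opnorm_le => [|x]; first by rewrite invr_ge0 ltW.
  rewrite ler_pdivlMl // mulrBl lerBlDr -nrmZ.
  apply: le_trans (lerD (lexx _) (nrm_le_opnorm A (B x))).
  have -> : z *: B x = A (B x) - x.
    by apply/esym/eqP; rewrite subr_eq addrC -subr_eq; apply/eqP; exact: BA.
  by apply: le_trans (nrmD _ _) _; rewrite nrmN addrC.
rewrite -[leRHS]mul1r ler_pdivlMr // => bk.
move: bb zA bk; set N := opnorm A in A0 k0 *; set w := nrm z in k0 *.
move=> bb zA bk.
have : (N + w) * (b * r) * (w - N) <= (N + w) * r.
  rewrite -mulrA; apply: ler_wpM2l; first by lra.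
  by rewrite mulrAC -[leRHS]mul1r ler_wpM2r // ltW.
have : (r + 2 * N) * (w - N) <= (N + w) * (b * r) * (w - N).
  by rewrite ler_wpM2r // ltW.
(* Together, [(r + 2 * N) * (w - N) <= (N + w) * r], that is [2 * N * (w - N) <= 2 * N * r],
   contradicting [r + N < w]. *)
by nra.
Qed.

(** Every positive [e] outside [S] bounds the distance from above, and every real above [max_pos S]
    is such an [e]. *)
Lemma dist_instability_le (X_nonzero : exists x : X, x != 0) A :
  (dist_instability A <= max_pos [set eps : R | (0 < eps)%R /\
       cond_pseudospectrum (eps / (eps + 2 * opnorm A))%R A
         `&` right_half_plane = set0])%E.
Proof.
set S := [set eps | _]; set D := dist_instability A.
have DS e : 0 < e -> ~ S e -> (D <= e%:E)%E.
  move=> e0 Se; have N0 := opnorm_ge0 A.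
  have [z [zA z0]] : cond_pseudospectrum (e / (e + 2 * opnorm A)) A
         `&` right_half_plane !=set0.
    by apply/set0P/eqP => SE; apply: Se.
  move: N0; rewrite le_eqVlt => /orP[/eqP A0|A0].
    (* If [A] has norm 0, the parameter is 1 and [z] carries no information; but [e I] has norm at
       most [e] and puts [e] in the spectrum, as [X] is nonzero. *)
    pose E : BL X := e%:C%C \*: idfun.
    apply: le_trans (_ : _ <= (opnorm E)%:E)%E _.
      apply: (@dist_instability_le_opnorm A E e%:C%C) => //= -[B [BK _]].
      have [x] := X_nonzero; rewrite -(BK x) /= addrK.
      have -> : A x = 0.
        apply/nrm_eq0/eqP; rewrite eq_le nrm_ge0 andbT.
        by rewrite (le_trans (nrm_le_opnorm _ _)) // -A0 mul0r.
      by rewrite bl0 eqxx.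
    rewrite lee_fin opnorm_le ?ltW // => x /=.
    by rewrite nrmZ Cnrm_real gtr0_norm.
  have eA : e < e + 2 * opnorm A by rewrite ltrDl mulr_gt0.
  have eA0 := lt_trans e0 eA.
  move: zA; rewrite /cond_pseudospectrum divr_gt0 // ltr_pdivrMr // mul1r eA /=.
  move=> [zA|[B AB cond]].
    (* [A] itself is unstable, so the zero perturbation serves. *)
    pose E : BL X := 0 \*: idfun.
    apply: le_trans (_ : _ <= (opnorm E)%:E)%E _.
      apply: (@dist_instability_le_opnorm A E z) => // -[B [BK KB]].
      apply: zA; exists B; split=> x; [rewrite -[RHS]BK|rewrite -[RHS]KB];
        by rewrite /= scale0r addr0.
    rewrite lee_fin opnorm_le ?ltW // => x /=.
    by rewrite scale0r normr0 mulr_ge0 ?nrm_ge0 ?ltW.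
  have Be := @inverse_opnorm_ge A B z e e0 A0 AB cond.
  (* The slack [d] makes [(e + d)^-1] strictly smaller than [opnorm B], whose norm need not be
     attained. *)
  apply/lee_addgt0Pr => d d0; have ed : 0 < e + d by rewrite addr_gt0.
  have [||E Ee zAE] := @spectrum_rank_one A B z (e + d)^-1 AB.
  - by rewrite invr_gt0.
  - by apply: lt_le_trans Be; rewrite ltf_pV2 ?posrE // ltrDl.
  rewrite invrK in Ee.
  apply: le_trans (dist_instability_le_opnorm _ _ _ z0 zAE) _.
  by rewrite -EFinD lee_fin.
have m0 : (0 <= max_pos S)%E by apply: ereal_sup_ubound; left.
have Sm e : S e -> (e%:E <= max_pos S)%E.
  by move=> Se; apply: ereal_sup_ubound; right; exists e.
move: m0 Sm; case: (max_pos S) => [m m0 Sm|_ _|//]; last exact: leey.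
apply/lee_addgt0Pr => e e0; rewrite lee_fin in m0; rewrite -EFinD; apply: DS.
  by rewrite ltr_wpDl.
by move=> /Sm; rewrite lee_fin; lra.
Qed.

End upper_bound.

Theorem theorem4p5 (R : realType) (X : completeNormedModType R[i])
    (X_nonzero : exists x : X, x != 0) (A : BL X) :
  (dist_instability A >=
     max_pos [set eps : R | 0 < eps /\
       cond_pseudospectrum (2 * eps / maxdist A) A
         `&` right_half_plane = set0]%R)%E /\
  (dist_instability A <=
     max_pos [set eps : R | 0 < eps /\
       cond_pseudospectrum (eps / (eps + 2 * opnorm A)) A
         `&` right_half_plane = set0]%R)%E.
Proof. by split; [exact: dist_instability_ge|exact: dist_instability_le]. Qed.
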